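(* Consider a reversible Markov decision problem (RMDP) with transition probability matrices $(P(u) : u \in \mathcal{U})$ on $\mathcal{X}$, $P(u)=[p_{ij}(u)]$, and reward function $r : \mathcal{X}\times\mathcal{U} \to \mathbb{R}$. Let $\mathcal{A}$ denote the set of articulation points and $\mathcal{B}$ the set of blocks in the block graph structure of its canonical graph $G = (\mathcal{X},\mathcal{E})$. Let $(P^{(0)}(B) : B \in \mathcal{B})$, $(\nu_a(u,B) : a \in \mathcal{A}, B \ni a, u \in \mathcal{U})$ and $\rho : \mathcal{X}\times\mathcal{U}\to(0,1]$ be a block representation of this RMDP (as defined in the context). Let $\bar\mu \in \bar{\mathcal{M}}$ and suppose that for some $B \in \mathcal{B}$ and $k \in \mathring{B}$ we have $$\frac{r(k,\bar\mu(k)) - \beta(\bar\mu)}{\rho(k,\bar\mu(k))} < \max_{w \in \mathcal{U}} \frac{r(k,w) - \beta(\bar\mu)}{\rho(k,w)}.$$ Let $v \in \mathcal{U}$ be an action achieving the maximum on the right-hand side, and let $\bar\mu' \in \bar{\mathcal{M}}$ be defined by $\bar\mu'(k) = v$ and $\bar\mu'(j) = \bar\mu(j)$ for all $j \neq k$. Then $\beta(\bar\mu') > \beta(\bar\mu)$.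
   Context: $\mathcal{X}$ (states) and $\mathcal{U}$ (actions) are finite sets, each of cardinality at least $2$. For each $u \in \mathcal{U}$, $P(u) = [p_{ij}(u)]$ is a transition probability matrix (row-stochastic matrix) on $\mathcal{X}$, and $r : \mathcal{X} \times \mathcal{U} \to \mathbb{R}$ is a reward function. A stationary randomized Markov strategy $\mu$ is a choice, for each $i \in \mathcal{X}$, of a probability distribution $(\mu(u|i) : u \in \mathcal{U})$ on $\mathcal{U}$; $\mathcal{M}$ is the set of all such strategies. For $\mu \in \mathcal{M}$, $P(\mu) = [p_{ij}(\mu)]$ with $p_{ij}(\mu) := \sum_u p_{ij}(u)\mu(u|i)$. $\bar{\mathcal{M}}$ is the set of stationary deterministic Markov strategies, i.e. functions $\bar\mu : \mathcal{X}\to\mathcal{U}$, regarded as elements of $\mathcal{M}$ via $\bar\mu(u|i) = 1$ if $u=\bar\mu(i)$ and $0$ otherwise. An irreducible transition probability matrix $P=[p_{ij}]$ with stationary distribution $(\pi_i)$ is reversible if $\pi_i p_{ij} = \pi_j p_{ji}$ for all $i,j$. The data form a reversible Markov decision problem (RMDP) if $P(\mu)$ is irreducible and reversible for every $\mu \in \mathcal{M}$. For $\mu\in\mathcal{M}$, $\pi(\mu) = (\pi_i(\mu))$ is the stationary distribution of $P(\mu)$ and $\beta(\mu)$ is the long-term average reward, $\beta(\mu) = \sum_i \pi_i(\mu) r(i,\mu)$ with $r(i,\mu) := \sum_u r(i,u)\mu(u|i)$. The canonical graph of an RMDP is the simple connected undirected graph $G = (\mathcal{X},\mathcal{E})$ (no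 multiple edges, no self-loops) such that for all $u \in \mathcal{U}$ and all distinct $i,j \in \mathcal{X}$, $p_{ij}(u) > 0$ if and only if $(i,j) \in \mathcal{E}$ (such a graph exists for every RMDP and is clearly unique). Block graph structure of a simple connected graph $G$: a cutvertex is a vertex whose removal, together with the edges connected to it, leaves a disconnected graph. A block is a maximal connected subgraph of $G$ that (as a graph in its own right) has no cutvertices. Two distinct blocks that intersect do so at a single vertex; such a vertex is called an articulation point. (Thus each articulation point lies in at least two blocks; if there is only one block there are no articulation points.) $\mathcal{A}$ is the set of articulation points, $\mathcal{B}$ the set of blocks; $B$ also denotes the vertex set of the block $B$, and $\mathring{B}$ denotes the set of vertices of $B$ that are not articulation points. Block representation of an RMDP: for each $B\in\mathcal{B}$ an irreducible reversible transition probability matrix $P^{(0)}(B)=[p^{(0)}_{ij}(B)]$ on $B$ with $p^{(0)}_{ii}(B)=0$ for all $i\in B$; for each $a\in\mathcal{A}$ (if any) and $u\in\mathcal{U}$, strictly positive numbers $(\nu_a(u,B): B\ni a)$ with $\sum_{B\ni a}\nu_a(u,B)=1$; and $\rho:\mathcal{X}\times\mathcal{U}\to(0,1]$; such that, with $\nu_i(u,B):=1$ for $i\in\mathring{B}$, for every $u\in\mathcal{U}$: $p_{ij}(u)=\rho(i,u)\nu_i(u,B)p^{(0)}_{ij}(B)$ if $i,j\in B$, $j\ne i$, $B\in\mathcal{B}$; $p_{ii}(u)=1-\rho(i,u)$ for $i\in\mathcal{X}$; and $p_{ij}(u)=0$ otherwise. (Every RMDP admits such a representation.) *)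

(* Defs.v *)
From mathcomp Require Import all_boot all_order all_algebra.
From mathcomp Require Import boolp classical_sets reals.

Set Implicit Arguments.
Unset Strict Implicit.
Unset Printing Implicit Defensive.

Import Order.TTheory GRing.Theory Num.Theory.
Local Open Scope ring_scope.

Section MarkovChains.
Context {R : realType} {T : finType}.
Implicit Types (P : T -> T -> R) (pi : T -> R).

Definition distribution pi : Prop :=
  (forall i, 0 <= pi i) /\ \sum_i pi i = 1.

Definition transition_matrix P : Prop := forall i, distribution (P i).

Definition irreducible P : Prop :=
  forall i j, connect [rel x y | 0 < P x y] i j.

Definition stationary P pi : Prop :=
  distribution pi /\ forall j, \sum_i pi i * P i j = pi j.

(* The stationary distribution of P; it is unique when P is an irreducible
   transition matrix, and the default value 0 is used only if none exists. *)
Definition stationary_dist P : T -> R := xget (fun=> 0) (stationary P).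

(* For irreducible P the witness is the unique stationary distribution. *)
Definition reversible P : Prop :=
  exists2 pi, stationary P pi & forall i j, pi i * P i j = pi j * P j i.

End MarkovChains.

Section Graphs.
Context {X : finType}.

(* (V, E) with E the set of ordered pairs of adjacent vertices: an undirected
   edge {i, j} is represented by both (i, j) and (j, i). *)
Definition graph : finType := ({set X} * {set X * X})%type.

Implicit Types (G H : graph) (x : X).

Definition verts G : {set X} := G.1.
Definition edges G : {set X * X} := G.2.

Definition simple_graph G : bool :=
  [forall i, forall j, ((i, j) \in edges G) ==>
     [&& i \in verts G, j \in verts G, i != j & (j, i) \in edges G]].

(* The empty graph counts as connected, so that deleting the only vertex of a
   one-vertex graph does not disconnect it. *)
Definition connected_graph G : bool :=
  [forall i in verts G, forall j in verts G,
     connect [rel x y | (x, y) \in edges G] i j].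

Definition remove_vertex G x : graph :=
  (verts G :\ x, [set e in edges G | (e.1 != x) && (e.2 != x)]).

Definition cutvertex G x : bool :=
  (x \in verts G) && ~~ connected_graph (remove_vertex G x).

Definition subgraph H G : bool :=
  [&& simple_graph H, verts H \subset verts G & edges H \subset edges G].

Definition connected_nocut G : bool :=
  connected_graph G && [forall x, ~~ cutvertex G x].

Definition is_block G H : bool :=
  [&& subgraph H G, connected_nocut H &
      [forall H' : graph,
         [&& subgraph H' G, connected_nocut H' & subgraph H H'] ==> (H' == H)]].

Definition blocks G : {set graph} := [set H | is_block G H].

Definition articulation_points G : {set X} :=
  [set a | [exists B1 in blocks G, exists B2 in blocks G,
     [&& B1 != B2, a \in verts B1 & a \in verts B2]]].

Definition block_interior G B : {set X} := verts B :\: articulation_points G.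

Definition vertex_of G : finType := {x : X | x \in verts G}.

End Graphs.
Arguments graph : clear implicits.

Section RMDP.
Context {R : realType} {X U : finType}.
(* p u i j stands for p_ij(u). *)
Implicit Types (p : U -> X -> X -> R) (r : X -> U -> R) (mu : X -> U -> R).

(* mu i u stands for mu(u | i). *)
Definition strategy mu : Prop := forall i, distribution (mu i).

Definition det_strategy (d : X -> U) : X -> U -> R := fun i u => (u == d i)%:R.

Definition induced_matrix p mu : X -> X -> R :=
  fun i j => \sum_u p u i j * mu i u.

Definition rmdp p : Prop :=
  [/\ (2 <= #|X|)%N, (2 <= #|U|)%N,
      forall u, transition_matrix (p u) &
      forall mu, strategy mu ->
        irreducible (induced_matrix p mu) /\ reversible (induced_matrix p mu)].

Definition average_reward p r mu : R :=
  \sum_i stationary_dist (induced_matrix p mu) i * \sum_u r i u * mu i u.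

Definition canonical_graph p (G : graph X) : Prop :=
  [/\ verts G = [set: X]%SET, simple_graph G, connected_graph G &
      forall u i j, i != j -> (0 < p u i j) = ((i, j) \in edges G)].

(* nu is only meaningful at the articulation points; this is its extension
   by 1 to the other vertices. *)
Definition nu_ext (G : graph X) (nu : X -> U -> graph X -> R) i u B : R :=
  if i \in articulation_points G then nu i u B else 1.

(* p0 B is a matrix on the vertices of B only; the values of p0 and nu at
   graphs B that are not blocks are irrelevant. *)
Record block_representation p (G : graph X)
    (p0 : forall B : graph X, vertex_of B -> vertex_of B -> R)
    (nu : X -> U -> graph X -> R) (rho : X -> U -> R) : Prop :=
  BlockRepresentation {
  p0_transition : forall B, B \in blocks G -> transition_matrix (p0 B);
  p0_irreducible : forall B, B \in blocks G -> irreducible (p0 B);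
  p0_reversible : forall B, B \in blocks G -> reversible (p0 B);
  p0_diag : forall B, B \in blocks G -> forall i, p0 B i i = 0;
  nu_gt0 : forall a u B, a \in articulation_points G -> B \in blocks G ->
    a \in verts B -> 0 < nu a u B;
  nu_sum : forall a u, a \in articulation_points G ->
    \sum_(B in blocks G | a \in verts B) nu a u B = 1;
  rho_bounds : forall i u, 0 < rho i u <= 1;
  p_in_block : forall u B (i j : vertex_of B), B \in blocks G -> j != i ->
    p u (val i) (val j)
      = rho (val i) u * nu_ext G nu (val i) u B * p0 B i j;
  p_diag : forall u i, p u i i = 1 - rho i u;
  p_otherwise : forall u i j, j != i ->
    (forall B, B \in blocks G -> ~~ ((i \in verts B) && (j \in verts B))) ->
    p u i j = 0
}.

Definition improvement_ratio p r (rho : X -> U -> R) (d : X -> U) k w : R :=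
  (r k w - average_reward p r (det_strategy d)) / rho k w.

End RMDP.

(* Main.v *)
Require Import Defs.
From mathcomp Require Import all_boot all_order all_algebra.
From mathcomp Require Import boolp classical_sets reals.
From mathcomp Require Import ring.

(** The reason why the theorem holds is a time change.  A vertex [k] that is not
an articulation point lies in one block only, so the block representation says
that every action [u] induces at [k] the same jump distribution and acts only
through the probability [rho k u] of jumping at all.  In terms of generators
[P - 1], the row of [k] under [u], divided by [rho k u], does not depend on
[u] ([generator_row_proportional]).

Passing from [mubar] to [mubar'] therefore rescales the rows of the generator,
by [rho i (mubar' i) / rho i (mubar i)].  If [pi] is stationary for [mubar] and
[w i] is the inverse factor, then [w i * pi i] is invariant for [mubar'], and
up to the normalization [\sum_i w i * pi i] it is the stationary distribution
of [mubar'] ([stationary_time_change]); it is the only one because an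
irreducible matrix has at most one ([stationary_unique]).

With [beta] the average reward of [mubar], this gives
[beta' - beta = (\sum_i pi i * w i * (r i (mubar' i) - beta)) / \sum_i w i * pi i].
Subtracting [\sum_i pi i * (r i (mubar i) - beta)], which is zero, from the
numerator turns it into the sum over [i] of [pi i * rho i (mubar i)] times the
increase of the improvement ratio at [i].  Only the term at [k] is nonzero, and
it is positive because the stationary distribution of an irreducible matrix
has full support ([stationary_gt0]). *)

Set Implicit Arguments.
Unset Strict Implicit.
Unset Printing Implicit Defensive.

Import Order.TTheory GRing.Theory Num.Theory.
Local Open Scope ring_scope.

(** * Stationary distributions of irreducible matrices *)

Section Stationary.
Context {R : realType} {T : finType}.
Implicit Types (P : T -> T -> R) (pi f w r : T -> R).

(** Invariance makes mass flow along the arcs of [P]: [f j] is at least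
[f i * P i j].  So a zero of [f] has only zeros as predecessors, and
irreducibility makes every state a predecessor of every other. *)
Lemma invariant_eq0 P f i0 :
  (forall i j, 0 <= P i j) -> irreducible P -> (forall i, 0 <= f i) ->
  (forall j, \sum_i f i * P i j = f j) -> f i0 = 0 -> forall i, f i = 0.
Proof.
move=> P_ge0 irrP f_ge0 fP fi0 i.
have /connectP[s] := irrP i i0.
elim: s i => [i _ /= <- //|j s IHs i /= /andP[Pij path_s] last_s].
have fj0 : f j = 0 by exact: IHs.
have /eqP := fP j; rewrite fj0 psumr_eq0 => [/allP/(_ i)|l _]; last first.
  exact: mulr_ge0.
by rewrite mem_index_enum mulf_eq0 (gt_eqF Pij) orbF => /(_ isT)/eqP.
Qed.

Lemma stationary_gt0 P pi i :
  (forall i j, 0 <= P i j) -> irreducible P -> stationary P pi -> 0 < pi i.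
Proof.
move=> P_ge0 irrP [[pi_ge0 pi1] piP].
rewrite lt_neqAle pi_ge0 andbT eq_sym; apply/eqP => pi_i0.
have pi0 := invariant_eq0 P_ge0 irrP pi_ge0 piP pi_i0.
by move/eqP: pi1; rewrite big1 // eq_sym oner_eq0.
Qed.

(** If [t] is the least ratio [pi i / sigma i], then [pi - t * sigma] is
nonnegative, invariant and has a zero, hence vanishes; total masses then force
[t = 1]. *)
Lemma stationary_unique P pi sigma :
  (forall i j, 0 <= P i j) -> irreducible P ->
  stationary P pi -> stationary P sigma -> pi =1 sigma.
Proof.
move=> P_ge0 irrP st_pi st_sigma i1.
have sigma_gt0 i := stationary_gt0 i P_ge0 irrP st_sigma.
case: st_pi st_sigma => [[_ pi1] piP] [[_ sigma1] sigmaP].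
pose ratio i := pi i / sigma i.
case: (@Order.TotalTheory.arg_minP _ _ T i1 xpredT ratio isT) => i0 _ ratio_min.
set t := ratio i0 in ratio_min.
have pi_t i : pi i = t * sigma i.
  apply/eqP; rewrite -subr_eq0; apply/eqP.
  apply: (@invariant_eq0 P (fun i => pi i - t * sigma i) i0) => // [j|j|].
  - by rewrite subr_ge0 -ler_pdivlMr // ratio_min.
  - under eq_bigr do rewrite mulrBl -mulrA.
    by rewrite sumrB -mulr_sumr piP sigmaP.
  - by rewrite /t /ratio divfK ?subrr // gt_eqF.
have t1 : t = 1.
  by rewrite -pi1 (eq_bigr _ (fun i _ => pi_t i)) -mulr_sumr sigma1 mulr1.
by rewrite pi_t t1 mul1r.
Qed.

Lemma stationary_distE P pi :
  (forall i j, 0 <= P i j) -> irreducible P -> stationary P pi ->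
  stationary_dist P =1 pi.
Proof.
move=> P_ge0 irrP st_pi.
apply: (stationary_unique P_ge0 irrP _ st_pi).
exact: (xgetPex _ (ex_intro _ pi st_pi)).
Qed.

(** * Time changes *)

(** Invariance of [pi] says that [pi] annihilates the generator [P - 1], and
[w i * pi i] pairs with row [i] of [P' - 1] as [pi i] does with row [i] of
[P - 1]. *)
Lemma stationary_time_change P P' pi w :
  (forall i, 0 < w i) ->
  (forall i j, w i * (P' i j - (i == j)%:R) = P i j - (i == j)%:R) ->
  stationary P pi -> 0 < \sum_i w i * pi i ->
  stationary P' (fun i => w i * pi i / \sum_l w l * pi l).
Proof.
move=> w_gt0 genP [[pi_ge0 pi1] piP]; set Z := \sum_i _ => Z_gt0.
have sum_delta f j : \sum_i f i * (i == j)%:R = f j.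
  rewrite (bigD1 j) //= eqxx mulr1 big1 ?addr0 // => i /negPf->.
  by rewrite mulr0.
split=> [|j]; first split=> [i|].
- by rewrite divr_ge0 ?mulr_ge0 // ltW.
- by rewrite -mulr_suml divff // gt_eqF.
have inv_j : \sum_i w i * pi i * (P' i j - (i == j)%:R) = 0.
  under eq_bigr do rewrite mulrAC genP mulrC mulrBr.
  by rewrite sumrB piP sum_delta subrr.
under eq_bigr do rewrite mulrAC; rewrite -mulr_suml; congr (_ / _).
apply/eqP; rewrite -subr_eq0 -[X in _ - X](sum_delta (fun i => w i * pi i)).
by rewrite -sumrB -{2}inv_j; under eq_bigr do rewrite -mulrBr.
Qed.

(** The factor [w i] is the ratio of the mean holding times at [i] after and
before the change, so the criterion compares rewards, in excess of the
current average, accumulated per visit. *)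
Lemma time_change_average_lt P P' pi w r r' k
    (beta := \sum_i pi i * r i) :
  (forall i, 0 < w i) ->
  (forall i j, w i * (P' i j - (i == j)%:R) = P i j - (i == j)%:R) ->
  (forall i j, 0 <= P i j) -> irreducible P -> stationary P pi ->
  (forall i j, 0 <= P' i j) -> irreducible P' ->
  (forall i, i != k -> w i * (r' i - beta) = r i - beta) ->
  r k - beta < w k * (r' k - beta) ->
  beta < \sum_i stationary_dist P' i * r' i.
Proof.
move=> w_gt0 genP P_ge0 irrP st_pi P'_ge0 irrP' eq_off gain_k.
have pi_gt0 i := stationary_gt0 i P_ge0 irrP st_pi.
have pi1 : \sum_i pi i = 1 by case: st_pi => -[].
have Z_gt0 : 0 < \sum_i w i * pi i.
  rewrite (bigD1 k) //= ltr_pwDl ?mulr_gt0 //.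
  by apply: sumr_ge0 => i _; rewrite ltW ?mulr_gt0.
have st' := stationary_time_change w_gt0 genP st_pi Z_gt0.
under eq_bigr do rewrite (stationary_distE P'_ge0 irrP' st') mulrAC.
rewrite -mulr_suml ltr_pdivlMr // mulr_sumr -subr_gt0 -sumrB.
have pi_centred : \sum_i pi i * (r i - beta) = 0.
  by under eq_bigr do rewrite mulrBr; rewrite sumrB -mulr_suml pi1 mul1r subrr.
rewrite -{1}pi_centred -subr_gt0.
rewrite [X in X - _](_ : _ = \sum_i pi i * (w i * (r' i - beta))); last first.
  by apply: eq_bigr => i _; ring.
rewrite -sumrB (bigD1 k) //= big1 ?addr0 => [|i ik].
  by rewrite -mulrBr mulr_gt0 // subr_gt0.
by rewrite eq_off // subrr.
Qed.

End Stationary.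

(** * Deterministic strategies *)

Section Deterministic.
Context {R : realType} {X U : finType}.
Implicit Types (p : U -> X -> X -> R) (r : X -> U -> R) (d : X -> U).

Lemma sum_det_strategy (f : U -> R) d i :
  \sum_u f u * det_strategy d i u = f (d i).
Proof.
rewrite (bigD1 (d i)) //= /det_strategy eqxx mulr1 big1 ?addr0 // => u /negPf->.
by rewrite mulr0.
Qed.

Lemma det_strategyP d : strategy (det_strategy d : X -> U -> R).
Proof.
move=> i; split=> [u|]; first exact: ler0n.
by have := sum_det_strategy (fun=> 1) d i; under eq_bigr do rewrite mul1r.
Qed.

Lemma induced_det p d i j : induced_matrix p (det_strategy d) i j = p (d i) i j.
Proof. exact: sum_det_strategy. Qed.

Lemma average_reward_det p r d :
  average_reward p r (det_strategy d) =
    \sum_i stationary_dist (induced_matrix p (det_strategy d)) i * r i (d i).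
Proof. by apply: eq_bigr => i _; rewrite sum_det_strategy. Qed.

(** * Actions at a non-articulation vertex *)

(** Off the articulation points the weights [nu] are 1, so on the
neighbours of [k] the row of [k] is [rho k u] times a row of the
action-independent matrix [p0]; on the diagonal, [p u k k - 1 = - rho k u]. *)
Lemma generator_row_proportional p (G : graph X)
    (p0 : forall B : graph X, vertex_of B -> vertex_of B -> R) nu rho k u v j :
  block_representation p G p0 nu rho -> k \notin articulation_points G ->
  rho k u * (p v k j - (k == j)%:R) = rho k v * (p u k j - (k == j)%:R).
Proof.
move=> rep /negPf k_nart; have [<-|kj] := eqVneq k j.
  by rewrite !(p_diag rep) /=; ring.
rewrite eq_sym in kj; rewrite !subr0 /=.
have [/existsP[B /and3P[hB kB jB]]|noB] :=
    boolP [exists B, [&& B \in blocks G, k \in verts B & j \in verts B]].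
  have pE := @p_in_block _ _ _ _ _ _ _ _ rep _ B (Sub k kB) (Sub j jB) hB kj.
  by rewrite !pE /nu_ext !SubK k_nart; ring.
have p_0 w : p w k j = 0.
  apply: (p_otherwise rep) => // B hB.
  by apply: contra noB => /andP[kB jB]; apply/existsP; exists B; apply/and3P.
by rewrite !p_0 !mulr0.
Qed.

End Deterministic.

Theorem theorem4 (R : realType) (X U : finType)
    (p : U -> X -> X -> R) (r : X -> U -> R)
    (hp : rmdp p)
    (G : graph X) (hG : canonical_graph p G)
    (p0 : forall B : graph X, vertex_of B -> vertex_of B -> R)
    (nu : X -> U -> graph X -> R) (rho : X -> U -> R)
    (hrep : block_representation p G p0 nu rho)
    (mubar : X -> U)
    (B : graph X) (hB : B \in blocks G)
    (k : X) (hk : k \in block_interior G B)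
    (hlt : improvement_ratio p r rho mubar k (mubar k)
      < \big[Num.max/improvement_ratio p r rho mubar k (mubar k)]_(w : U)
          improvement_ratio p r rho mubar k w)
    (v : U)
    (hv : improvement_ratio p r rho mubar k v
      = \big[Num.max/improvement_ratio p r rho mubar k (mubar k)]_(w : U)
          improvement_ratio p r rho mubar k w)
    (mubar' : X -> U) (hk' : mubar' k = v)
    (hj' : forall j, j != k -> mubar' j = mubar j) :
  average_reward p r (det_strategy mubar)
    < average_reward p r (det_strategy mubar').
Proof.
case: hp => _ _ p_tm p_mu.
have k_nart : k \notin articulation_points G by move: hk; rewrite inE => /andP[].
have rho_gt0 i u : 0 < rho i u by case/andP: (rho_bounds hrep i u).
have gain : improvement_ratio p r rho mubar k (mubar k)
    < improvement_ratio p r rho mubar k (mubar' k) by rewrite hk' hv.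
have ind_ge0 d i j : 0 <= induced_matrix p (det_strategy d) i j.
  by rewrite induced_det; case: (p_tm (d i) i).
have irr d : irreducible (induced_matrix p (det_strategy d)).
  by case: (p_mu _ (det_strategyP d)).
have [_ [pi st_pi _]] := p_mu _ (det_strategyP mubar).
have piE := stationary_distE (ind_ge0 mubar) (irr mubar) st_pi.
have betaE : average_reward p r (det_strategy mubar)
    = \sum_i pi i * r i (mubar i).
  by rewrite average_reward_det; apply: eq_bigr => i _; rewrite piE.
move: gain; rewrite /improvement_ratio (average_reward_det p r mubar') betaE.
move=> gain.
apply: (@time_change_average_lt _ _ (induced_matrix p (det_strategy mubar)) _ pi
  (fun i => rho i (mubar i) / rho i (mubar' i)) _ (fun i => r i (mubar' i)) k)
  => // [i|i j|i ik|].
- exact: divr_gt0.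
- rewrite !induced_det; have [->|ik] := eqVneq i k.
    rewrite mulrAC (generator_row_proportional _ (mubar' k) _ hrep) //.
    by rewrite mulrAC divff ?mul1r // gt_eqF.
  by rewrite (hj' _ ik) divff ?mul1r // gt_eqF.
- by rewrite (hj' _ ik) divff ?mul1r // gt_eqF.
- by move: gain; rewrite ltr_pdivrMr // mulrC mulrA mulrAC.
Qed.
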